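(* Let $\lambda,\mu$ be two partitions of length $m$ such that $k=\frac{|\mu|-|\lambda|}{2}$ is a nonnegative integer. Set $n=\max(\lambda_1,\mu_1)$, $\widehat{\lambda}=(n-\lambda_m,\dots,n-\lambda_1)$ and $\widehat{\mu}=(n-\mu_m,\dots,n-\mu_1)$. Then $$u_{\lambda,\mu}(q)=\sum_{\delta\in\mathcal{D}_k^m}c_\delta^{D_m}\,q^{\frac{|\mu|-|\lambda|}{2}}K^{A_m}_{\widehat{\lambda},\widehat{\mu}+\delta}(q)\quad\text{and}\quad U_{\lambda,\mu}(q)=\sum_{\delta\in\mathcal{C}_k^m}c_\delta^{C_m}\,q^{\frac{|\mu|-|\lambda|}{2}}K^{A_m}_{\widehat{\lambda},\widehat{\mu}+\delta}(q).$$
   Context: A partition of length $m$ is a sequence $\lambda_1\ge\dots\ge\lambda_m\ge 0$ of integers (zero parts allowed). $\varepsilon_1,\dots,\varepsilon_m$ is the standard basis of $\mathbb{Z}^m$, $|\alpha|=\alpha_1+\dots+\alpha_m$, $\rho_m=(m,m-1,\dots,1)$. $\mathcal{S}_m$ acts on $\mathbb{Z}^m$ by permuting coordinates; $l$ is Coxeter length. The functions $f_q,F_q$ on $\mathbb{Z}^m$ are defined by (geometric series expansions in $q\,x_i/x_j$ and $q/(x_rx_s)$) $$\prod_{1\le i<j\le m}\frac{1}{1-q\frac{x_i}{x_j}}\prod_{1\le r<s\le m}\frac{1}{1-\frac{q}{x_rx_s}}=\sum_{\alpha\in\mathbb{Z}^m}f_q(\alpha)x^\alpha,\qquad \prod_{1\le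 i<j\le m}\frac{1}{1-q\frac{x_i}{x_j}}\prod_{1\le r\le s\le m}\frac{1}{1-\frac{q}{x_rx_s}}=\sum_{\alpha\in\mathbb{Z}^m}F_q(\alpha)x^\alpha ,$$ and $$u_{\lambda,\mu}(q)=\sum_{\sigma\in\mathcal{S}_m}(-1)^{l(\sigma)}f_q(\sigma(\lambda+\rho_m)-\mu-\rho_m),\qquad U_{\lambda,\mu}(q)=\sum_{\sigma\in\mathcal{S}_m}(-1)^{l(\sigma)}F_q(\sigma(\lambda+\rho_m)-\mu-\rho_m).$$ For a nonnegative integer $k$, $\mathcal{C}_k^m$ (resp. $\mathcal{D}_k^m$) is the finite set of $\beta\in\mathbb{Z}^m$ with $|\beta|=2k$ which can be written $\beta=\sum_{1\le r\le s\le m}e_{r,s}(\varepsilon_r+\varepsilon_s)$ (resp. $\beta=\sum_{1\le r<s\le m}e_{r,s}(\varepsilon_r+\varepsilon_s)$) with integers $e_{r,s}\ge0$; $c_\beta^{C_m}$ (resp. $c_\beta^{D_m}$) is the number of such families $(e_{r,s})$. The type $A$ $q$-partition function is defined by $\prod_{1\le i<j\le m}\frac{1}{1-q x_i/x_j}=\sum_{\beta\in\mathbb{Z}^m}\mathcal{P}_q^{A_m}(\beta)x^\beta$, and for a partition $\nu$ of length $m$ and any $\gamma\in\mathbb{Z}^m$, $$K^{A_m}_{\nu,\gamma}(q)=\sum_{\sigma\in\mathcal{S}_m}(-1)^{l(\sigma)}\mathcal{P}_q^{A_m}(\sigma(\nu+\rho_m)-(\gamma+\rho_m)).$$ *)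

(* Defs.v *)
From HB Require Import structures.
From mathcomp Require Import all_boot all_order all_algebra all_fingroup.
From mathcomp Require Import finmap.
From mathcomp Require Import boolp classical_sets functions cardinality fsbigop.

Set Implicit Arguments.
Unset Strict Implicit.
Unset Printing Implicit Defensive.

Import Order.TTheory GRing.Theory Num.Theory.
Local Open Scope classical_set_scope.
Local Open Scope ring_scope.

(* Z^m is ['rV[int]_m], with coordinates numbered from 0 as usual in MathComp,
   and q is the indeterminate ['X] of [{poly int}]. *)

Definition eps (m : nat) (i : 'I_m) : 'rV[int]_m := delta_mx 0 i.

Definition weight (m : nat) (a : 'rV[int]_m) : int := \sum_i a 0 i.

Definition rho (m : nat) : 'rV[int]_m := \row_(i < m) (m - i)%:Z.

Definition is_partition (m : nat) (a : 'rV[int]_m) : Prop :=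
  (forall i j : 'I_m, (i <= j)%N -> a 0 j <= a 0 i) /\
  (forall i : 'I_m, 0 <= a 0 i).

(* The left action sending [eps i] to [eps (s i)]. *)
Definition permact (m : nat) (s : 'S_m) (a : 'rV[int]_m) : 'rV[int]_m :=
  \row_i a 0 ((s^-1)%g i).

Definition simple_reflections (m : nat) : {set 'S_m} :=
  [set s | [exists i : 'I_m, exists j : 'I_m,
      (j == i.+1 :> nat) && (s == tperm i j)]]%SET.

Definition has_word (m : nat) (s : 'S_m) (n : nat) : bool :=
  [exists w : {ffun 'I_n -> 'S_m},
      [forall i, w i \in simple_reflections m] && (s == \prod_i w i)%g].

Lemma has_word_ex (m : nat) (s : 'S_m) : exists n, has_word s n.
Proof.
suff /gen_prodgP[n [c cS ->]] : s \in <<simple_reflections m>>%g.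
  exists n; apply/existsP; exists [ffun i => c i]; apply/andP; split.
    by apply/forallP => i; rewrite ffunE.
  by apply/eqP; apply: eq_bigr => i _; rewrite ffunE.
have tS d : forall i j : 'I_m, (i + d = j)%N ->
    tperm i j \in <<simple_reflections m>>%g.
  elim: d => [|d IHd] i j ij.
    suff -> : i = j by rewrite tperm1 group1.
    by apply: val_inj; move: ij; rewrite addn0.
  have km : (i + d < m)%N by rewrite -addnS ij ltnW.
  pose k := Ordinal km.
  have kj : tperm k j \in <<simple_reflections m>>%g.
    apply: mem_gen; rewrite inE; apply/existsP; exists k; apply/existsP.
    by exists j; rewrite eqxx andbT -ij addnS.
  have [->//|ik] := eqVneq i k.
  have ineqj : j != i by rewrite -val_eqE /= -ij -[X in _ != X]addn0 eqn_add2l.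
  suff -> : tperm i j = (tperm i k ^ tperm k j)%g
    by apply: groupJ kj; apply: IHd.
  by rewrite tpermJ tpermL tpermD // eq_sym.
case: (prod_tpermP s) => ts -> _; apply: group_prod => -[i j] _ /=.
case: (leqP i j) => ij; first by apply: (tS (j - i)%N); rewrite subnKC.
by rewrite tpermC; apply: (tS (i - j)%N); rewrite subnKC // ltnW.
Qed.

Definition coxeter_length (m : nat) (s : 'S_m) : nat := ex_minn (has_word_ex s).

(* Formal series \sum_a A(a) x^a, a in Z^m, with coefficients in Z[q], given by
   their coefficient function.  [\sum_(_ \in _)] is a sum with finite support,
   with value 0 when the support is infinite.  This default is never met below:
   with theta(a) = - \sum_i (i+1) a_i, each exponent g of the geometric series
   multiplied below (eps_i - eps_j with i < j, and -(eps_r + eps_s)) satisfies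
   theta(g) > 0, so all Cauchy products are finite. *)
Definition series (m : nat) := 'rV[int]_m -> {poly int}.

Definition sone (m : nat) : series m := fun a => (a == 0)%:R.
Arguments sone : clear implicits.

Definition smul (m : nat) (A B : series m) : series m :=
  fun a => \sum_(b \in [set: 'rV[int]_m]) A b * B (a - b).

(* 1 / (1 - q x^g) = \sum_n q^n x^(n g), for g != 0. *)
Definition geom (m : nat) (g : 'rV[int]_m) : series m :=
  fun a => \sum_(n \in [set n : nat | g *+ n = a]) ('X^n : {poly int}).

Definition prodA (m : nat) : series m :=
  \big[@smul m/sone m]_(p : 'I_m * 'I_m | (p.1 < p.2)%N)
    geom (eps p.1 - eps p.2).
Arguments prodA : clear implicits.

Definition prodD (m : nat) : series m :=
  \big[@smul m/sone m]_(p : 'I_m * 'I_m | (p.1 < p.2)%N)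
    geom (- (eps p.1 + eps p.2)).
Arguments prodD : clear implicits.

Definition prodC (m : nat) : series m :=
  \big[@smul m/sone m]_(p : 'I_m * 'I_m | (p.1 <= p.2)%N)
    geom (- (eps p.1 + eps p.2)).
Arguments prodC : clear implicits.

Definition fq (m : nat) : series m := smul (prodA m) (prodD m).
Arguments fq : clear implicits.

Definition Fq (m : nat) : series m := smul (prodA m) (prodC m).
Arguments Fq : clear implicits.

Definition partition_fun_A (m : nat) : series m := prodA m.
Arguments partition_fun_A : clear implicits.

Definition u (m : nat) (lambda mu : 'rV[int]_m) : {poly int} :=
  \sum_(s : 'S_m) (-1) ^+ coxeter_length s *
    fq m (permact s (lambda + rho m) - mu - rho m).

Definition U (m : nat) (lambda mu : 'rV[int]_m) : {poly int} :=
  \sum_(s : 'S_m) (-1) ^+ coxeter_length s *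
    Fq m (permact s (lambda + rho m) - mu - rho m).

Definition KA (m : nat) (nu gamma : 'rV[int]_m) : {poly int} :=
  \sum_(s : 'S_m) (-1) ^+ coxeter_length s *
    partition_fun_A m (permact s (nu + rho m) - (gamma + rho m)).

Definition pairsC (m : nat) := {p : 'I_m * 'I_m | (p.1 <= p.2)%N}.

Definition pairsD (m : nat) := {p : 'I_m * 'I_m | (p.1 < p.2)%N}.

Definition sumC (m : nat) (e : {ffun pairsC m -> nat}) : 'rV[int]_m :=
  \sum_p (eps (val p).1 + eps (val p).2) *+ e p.

Definition sumD (m : nat) (e : {ffun pairsD m -> nat}) : 'rV[int]_m :=
  \sum_p (eps (val p).1 + eps (val p).2) *+ e p.

Definition Cset (m k : nat) : set 'rV[int]_m :=
  [set beta | weight beta = (2 * k)%:Z /\ exists e, beta = sumC e].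
Arguments Cset : clear implicits.

Definition Dset (m k : nat) : set 'rV[int]_m :=
  [set beta | weight beta = (2 * k)%:Z /\ exists e, beta = sumD e].
Arguments Dset : clear implicits.

(* The sets of families below are finite, since weight (sumC e) = 2 \sum_p e p
   bounds the entries of e; [fset_set] therefore does not lose anything. *)
Definition cC (m : nat) (beta : 'rV[int]_m) : nat :=
  #|` fset_set [set e : {ffun pairsC m -> nat} | beta = sumC e] |%fset.

Definition cD (m : nat) (beta : 'rV[int]_m) : nat :=
  #|` fset_set [set e : {ffun pairsD m -> nat} | beta = sumD e] |%fset.

Definition hat (m : nat) (n : int) (a : 'rV[int]_m) : 'rV[int]_m :=
  \row_i (n - a 0 (rev_ord i)).

(* Main.v *)
Require Import Defs.
From HB Require Import structures.
From mathcomp Require Import all_boot all_order all_algebra all_fingroup.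
From mathcomp Require Import finmap.
From mathcomp Require Import boolp classical_sets functions cardinality fsbigop.
From mathcomp Require Import zify ring.

(* Write R for the reversal of coordinates. Expanding the products, prodA, prodC
   and prodD count families of exponents, so the coefficient of x^(-delta) in the
   second factor of f_q or F_q is c_delta q^(|delta|/2). As prodA is supported in
   weight 0, only the delta with |delta| = 2k contribute to u and U, and
     u = sum_delta c_delta q^k sum_s sgn(s) P(s(lambda+rho) - mu - rho + delta).
   The involution a |-> - R a permutes the positive roots eps_i - eps_j, hence
   preserves P; together with s |-> R s R it turns the inner sum into
   K_{hat lambda, hat mu + R delta}. Finally R permutes the exponents
   eps_r + eps_s, so c_{R delta} = c_delta. *)

Set Implicit Arguments.
Unset Strict Implicit.
Unset Printing Implicit Defensive.

Import Order.TTheory GRing.Theory Num.Theory.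
Local Open Scope ring_scope.
Local Open Scope classical_set_scope.

(** Outside the finite image of [A] under [h] the fibres are empty, so the outer sum has finite
    support and can be exchanged with the sum over [A]; each [x] then survives only at [j = h x]. *)
Lemma fsbig_fibers (R : Type) (idx : R) (op : Monoid.com_law idx)
    (I J : choiceType) (h : I -> J) (A : set I) (F : I -> R) : finite_set A ->
  \big[op/idx]_(x \in A) F x =
  \big[op/idx]_(j \in [set: J]) \big[op/idx]_(x \in A `&` h @^-1` [set j]) F x.
Proof.
move=> finA.
rewrite -(@fsbig_widen _ _ _ op (h @` A)) //; last first.
  move=> j [_ nj]; apply: fsbig1 => x [Ax hx].
  by case: nj; exists x.
under [RHS]eq_fsbigr do rewrite fsbig_mkcondr.
rewrite exchange_fsbig //; last exact: finite_image.
apply: eq_fsbigr => x /set_mem Ax.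
rewrite (fsbigD1 (h x)) ?fsbig1;
  [ |move=> j [_ /= hj]..|exact: finite_image|by exists x].
  by rewrite ifT ?inE // Monoid.mulm1.
by case: ifP => //; rewrite inE => /esym.
Qed.

Lemma finite_ffun_bounded (I : finType) (N : nat) :
  finite_set [set e : {ffun I -> nat} | forall i, (e i <= N)%N].
Proof.
apply: (@sub_finite_set _ _
  [set [ffun i => f i : nat] | f in [set: {ffun I -> 'I_N.+1}]]).
  move=> e /= eN; exists [ffun i => inord (e i)] => //.
  by apply/ffunP => i; rewrite !ffunE inordK // ltnS.
exact: finite_image.
Qed.

(** * Products of geometric series as generating functions of families of exponents *)

Section ProductsOfGeometricSeries.

Variable m : nat.
Implicit Types (a b g : 'rV[int]_m) (t : 'I_m -> int) (B : series m).

(** The linear form with coefficients [t]. A form positive on all the exponents forces finiteness of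
    the families; the form with all coefficients 1 is the weight. *)
Definition pairing t a : int := \sum_i t i * a 0 i.

Lemma pairing_is_zmod_morphism t : zmod_morphism (pairing t).
Proof.
move=> a b; rewrite /pairing -sumrB.
by apply: eq_bigr => i _; rewrite !mxE mulrBr.
Qed.

HB.instance Definition _ t :=
  GRing.isZmodMorphism.Build _ _ (pairing t) (pairing_is_zmod_morphism t).

Lemma pairing_eps t i : pairing t (eps i) = t i.
Proof.
rewrite /pairing (bigD1 i) //= !mxE !eqxx mulr1 big1 ?addr0 // => j ji.
by rewrite !mxE (negbTE ji) andbF mulr0.
Qed.

Lemma weightE a : weight a = pairing (fun=> 1) a.
Proof. by apply: eq_bigr => i _; rewrite mul1r. Qed.

(** Since Z^m is torsion free, the multiples of [g] are distinct, so [geom g] is 'X^n at [g *+ n]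
    and zero elsewhere. The supports of the two sums correspond, hence so do their default
    values. *)
Lemma smul_geom g B a : g != 0 ->
  smul (geom g) B a = \sum_(n \in [set: nat]) 'X^n * B (a - g *+ n).
Proof.
move=> g0; have gI : injective (fun n : nat => g *+ n).
  have [j gj] : exists j, g 0 j != 0.
    apply/existsP; apply: contraNT g0 => /existsPn g0; apply/eqP/rowP => j.
    by rewrite mxE; apply/eqP; rewrite -[_ == _]negbK g0.
  move=> n n' /(congr1 (fun v : 'rV_m => v 0 j)).
  by rewrite !mulmxnE => /(mulrIn gj).
rewrite /smul -(@fsbig_widen _ _ _ _ (range (fun n : nat => g *+ n))) //; last first.
  move=> b [_ nb]; rewrite /= /geom fsbig1 ?mul0r // => n /= nE.
  by case: nb; exists n.
rewrite fsbig_image; last by move=> n n' _ _; exact: gI.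
apply: eq_fsbigr => n _; congr (_ * _).
rewrite /geom (_ : [set n0 | _] = [set n]) ?fsbig_set1 //.
by apply/seteqP; split=> [n0 /gI|_ ->].
Qed.

Section Families.

Variables (I : finType) (g : I -> 'rV[int]_m) (t : 'I_m -> int).
Hypothesis g_gt0 : forall p, 0 < pairing t (g p).

(* [r] lists the exponents already multiplied in: the other ones must not occur. *)
Definition families (r : seq I) a : set {ffun I -> nat} :=
  [set e | (forall p, p \notin r -> e p = 0%N) /\ \sum_p g p *+ e p = a].

(** Each occurrence of [g p] adds at least 1 to [pairing t a], which therefore bounds every
    multiplicity. *)
Lemma finite_families r a : finite_set (families r a).
Proof.
apply: sub_finite_set (finite_ffun_bounded I `|pairing t a|).
move=> e [_ /= <-] p; rewrite raddf_sum; set s := \sum_i _.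
suff : (e p)%:Z <= s by lia.
rewrite /s (bigD1 p) //= raddfMn.
rewrite -[leLHS]addr0 lerD //; last first.
  by apply: sumr_ge0 => i _; rewrite raddfMn mulrn_wge0 // ltW // g_gt0.
by rewrite -natz ler_wMn2r // -gtz0_ge1 g_gt0.
Qed.

(** Induction on [r]: the families for [p :: r] are sorted by the multiplicity [n] of [p], and
    erasing it leaves a family for [r] with sum [a - g p *+ n]. *)
Lemma prod_geom_seq (r : seq I) a : uniq r ->
  (\big[@smul m/sone m]_(p <- r) geom (g p)) a =
  \sum_(e \in families r a) ('X^(\sum_p e p) : {poly int}).
Proof.
elim: r a => [|p r IHr] a /=.
  rewrite big_nil /sone => _; have [->|a0] := eqVneq a 0.
    rewrite (_ : families _ _ = [set [ffun=> 0%N]]).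
      by rewrite fsbig_set1 big1 // => p _; rewrite ffunE.
    apply/seteqP; split=> [e [e0 _]|e ->].
      by apply/ffunP => p; rewrite ffunE e0.
    by split=> [p _|]; rewrite ?ffunE // big1 // => p _; rewrite ffunE mulr0n.
  rewrite fsbig1 // => e [e0 /eqP]; rewrite big1; last first.
    by move=> p _; rewrite e0.
  by rewrite eq_sym (negbTE a0).
case/andP=> pr ur; rewrite big_cons smul_geom; last first.
  by apply: contraTneq (g_gt0 p) => ->; rewrite raddf0 ltxx.
rewrite (fsbig_fibers _ (fun e : {ffun I -> nat} => e p));
  last exact: finite_families.
apply: eq_fsbigr => n _; rewrite IHr // mulr_fsumr.
pose ins (e : {ffun I -> nat}) := [ffun i => if i == p then n else e i].
(* Stated for a general [F] to serve twice: for the vector sum of the family and for the exponent of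
   q. *)
have sum_ins (V : nmodType) (F : I -> nat -> V) (e : {ffun I -> nat}) :
    F p 0%N = 0 -> e p = 0%N ->
    \sum_i F i (ins e i) = F p n + \sum_i F i (e i).
  move=> F0 ep; rewrite (bigD1 p) //= [in RHS](bigD1 p) //= ep F0 add0r ffunE eqxx.
  by congr (_ + _); apply: eq_bigr => i ip; rewrite ffunE (negbTE ip).
have sum_insg (e : {ffun I -> nat}) : e p = 0%N ->
    \sum_i g i *+ ins e i = g p *+ n + \sum_i g i *+ e i.
  by move=> e0; apply: (sum_ins _ (fun i k => g i *+ k)); rewrite ?mulr0n.
rewrite [RHS](reindex_fsbig ins (families r (a - g p *+ n))); last first.
  split.
  - move=> e [e0 ea]; split; last by rewrite /= ffunE eqxx.
    split=> [i|]; first by rewrite inE negb_or ffunE => /andP[/negbTE-> /e0].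
    by rewrite sum_insg ?e0 // ea addrC subrK.
  - move=> e e' /set_mem [e0 _] /set_mem [e0' _] /ffunP ee'.
    apply/ffunP => i; have := ee' i; rewrite !ffunE; case: eqP => // -> _.
    by rewrite e0 ?e0'.
  - move=> e [[e0 ea] /= en].
    have insK : ins [ffun i => if i == p then 0%N else e i] = e.
      by apply/ffunP => i; rewrite !ffunE; case: eqP => // ->.
    exists [ffun i => if i == p then 0%N else e i] => //; split.
      move=> i ir; rewrite ffunE; case: eqP => // /eqP ip.
      by apply: e0; rewrite inE negb_or ip.
    apply: (addrI (g p *+ n)).
    by rewrite -sum_insg ?ffunE ?eqxx // insK ea addrC subrK.
apply: eq_fsbigr => e /set_mem [e0 _].
by rewrite (sum_ins _ (fun=> id)) ?e0 // exprD.
Qed.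

End Families.

Lemma prod_geomE (J : finType) (P : pred J) (g : J -> 'rV[int]_m) t a :
    (forall p, P p -> 0 < pairing t (g p)) ->
  (\big[@smul m/sone m]_(p | P p) geom (g p)) a =
  \sum_(e \in [set e : {ffun {p | P p} -> nat} | \sum_p g (val p) *+ e p = a])
    ('X^(\sum_p e p) : {poly int}).
Proof.
move=> g_gt0; rewrite -big_filter.
(* [r] runs through the whole subtype, so the support condition in [families] becomes vacuous. *)
pose r : seq {p | P p} := pmap insub (index_enum J).
have <- : map val r = filter P (index_enum J).
  rewrite (pmap_filter (insubK _)); apply: eq_filter => p.
  by rewrite /= isSome_insub.
rewrite big_map (prod_geom_seq (t := t)); first last.
- exact: pmap_sub_uniq (index_enum_uniq J).
- by move=> p; apply: g_gt0 (valP p).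
apply: eq_fsbigl; apply/seteqP; split=> [e []//|e ea]; split=> // p.
by rewrite mem_pmap_sub mem_index_enum.
Qed.

(** Relabelling a family by [tau] applies [phi] to its sum and keeps its total multiplicity, hence
    its power of q. *)
Lemma prod_geom_symm (J : finType) (P : pred J) (g : J -> 'rV[int]_m) t
    (tau : J -> J) (phi : {additive 'rV[int]_m -> 'rV[int]_m}) a :
    (forall p, P p -> 0 < pairing t (g p)) ->
    (forall p, P (tau p) = P p) -> involutive tau ->
    injective phi -> (forall p, g (tau p) = phi (g p)) ->
  (\big[@smul m/sone m]_(p | P p) geom (g p)) (phi a) =
  (\big[@smul m/sone m]_(p | P p) geom (g p)) a.
Proof.
move=> g_gt0 Ptau tauK phiI gtau; rewrite !(prod_geomE (t := t)) //.
have PT (x : {p | P p}) : P (tau (val x)) by rewrite Ptau (valP x).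
pose T (x : {p | P p}) : {p | P p} := Sub (tau (val x)) (PT x).
have TK : involutive T by move=> x; apply: val_inj => /=.
pose h (e : {ffun {p | P p} -> nat}) := [ffun x => e (T x)].
have hK : involutive h by move=> e; apply/ffunP => x; rewrite !ffunE TK.
have hsum e : \sum_p g (val p) *+ h e p = phi (\sum_p g (val p) *+ e p).
  rewrite raddf_sum (reindex_inj (inv_inj TK)) /=; apply: eq_bigr => p _.
  by rewrite ffunE TK gtau raddfMn.
rewrite [LHS](reindex_fsbig h
  [set e : {ffun {p | P p} -> nat} | \sum_p g (val p) *+ e p = a]).
  apply: eq_fsbigr => e _; congr ('X^_).
  by rewrite (reindex_inj (inv_inj TK)) /=; apply: eq_bigr => p _; rewrite ffunE TK.
split=> [e /= <-|e e' _ _ /(inv_inj hK)//|e /= ea]; first exact: hsum.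
by exists (h e); rewrite ?hK //=; apply: phiI; rewrite -hsum hK.
Qed.

End ProductsOfGeometricSeries.

(** A word in simple reflections is a product of transpositions, so its length has the parity of the
    permutation. The sign is thereby seen to be invariant under conjugation. *)
Lemma sign_coxeter_length (R : pzRingType) (m : nat) (s : 'S_m) :
  (-1) ^+ coxeter_length s = (-1) ^+ odd_perm s :> R.
Proof.
rewrite /coxeter_length.
case: ex_minnP => n /existsP[w /andP[/forallP wS /eqP ->]] _.
rewrite -signr_odd; congr (_ ^+ (nat_of_bool _)).
elim: n w wS => [|n IHn] w wS; first by rewrite big_ord0 odd_perm1.
rewrite big_ord_recl odd_permM /= (IHn [ffun i => w (lift ord0 i)]).
  have := wS ord0; rewrite inE => /existsP[i /existsP[j /andP[/eqP ij /eqP->]]].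
  rewrite odd_tperm (_ : i != j) //; last by apply: contra_eq_neq ij => ->; lia.
  by congr (~~ _); congr odd_perm; apply: eq_bigr => k _; rewrite ffunE.
by move=> i; rewrite ffunE.
Qed.

(** * The reversal of coordinates, on vectors and on pairs of indices *)

Section Reversal.

Variable m : nat.
Implicit Types a : 'rV[int]_m.

Definition rev_perm : 'S_m := perm (@rev_ord_inj m).

Definition rev_row a : 'rV[int]_m := col_perm rev_perm a.

(** The components are also swapped, because [rev_ord] is decreasing and the order within a pair has
    to be kept. *)
Definition rev_pair (p : 'I_m * 'I_m) := (rev_ord p.2, rev_ord p.1).

Lemma rev_permE i : rev_perm i = rev_ord i.
Proof. by rewrite permE. Qed.

Lemma rev_permV : (rev_perm^-1 = rev_perm)%g.
Proof.
apply/permP => i; apply: (@perm_inj _ rev_perm).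
by rewrite permKV !rev_permE rev_ordK.
Qed.

Lemma rev_row_is_zmod_morphism : zmod_morphism rev_row.
Proof. by move=> a b; apply/rowP => i; rewrite !mxE. Qed.

HB.instance Definition _ :=
  GRing.isZmodMorphism.Build _ _ rev_row rev_row_is_zmod_morphism.

Lemma rev_rowK : involutive rev_row.
Proof. by move=> a; apply/rowP => i; rewrite !mxE !rev_permE rev_ordK. Qed.

Lemma rev_row_eps i : rev_row (eps i) = eps (rev_ord i).
Proof.
apply/rowP => j; rewrite !mxE !rev_permE !eqxx /=.
by rewrite -(inj_eq rev_ord_inj) rev_ordK.
Qed.

Lemma rev_pairK : involutive rev_pair.
Proof. by case=> i j; rewrite /rev_pair /= !rev_ordK. Qed.

Lemma rev_pair_lt p : ((rev_pair p).1 < (rev_pair p).2)%N = (p.1 < p.2)%N.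
Proof. by case: p => i j /=; have := ltn_ord i; have := ltn_ord j; lia. Qed.

Lemma rev_pair_le p : ((rev_pair p).1 <= (rev_pair p).2)%N = (p.1 <= p.2)%N.
Proof. by case: p => i j /=; have := ltn_ord i; have := ltn_ord j; lia. Qed.

Lemma weight_rev_row a : weight (rev_row a) = weight a.
Proof.
rewrite /weight [RHS](reindex_inj (@rev_ord_inj m)).
by apply: eq_bigr => i _; rewrite mxE rev_permE.
Qed.

End Reversal.

(** * Additivity and permutation invariance of the weight *)

Section WeightLemmas.

Variable m : nat.
Implicit Types a b : 'rV[int]_m.

Lemma weightD a b : weight (a + b) = weight a + weight b.
Proof. by rewrite !weightE raddfD. Qed.

Lemma weightN a : weight (- a) = - weight a.
Proof. by rewrite !weightE raddfN. Qed.

Lemma weight_permact (s : 'S_m) a : weight (permact s a) = weight a.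
Proof.
rewrite /weight [RHS](reindex_inj (@perm_inj _ (s^-1)%g)).
by apply: eq_bigr => i _; rewrite mxE.
Qed.

End WeightLemmas.

(** * Symmetry of the type A partition function and of the polynomials [KA] *)

Section TypeA.

Variable m : nat.
Implicit Types a : 'rV[int]_m.

(** The form with coefficients -i takes the value j - i on eps_i - eps_j. *)
Lemma pairing_rootA_gt0 (p : 'I_m * 'I_m) : (p.1 < p.2)%N ->
  0 < pairing (fun i => - i%:Z) (eps p.1 - eps p.2).
Proof. by move=> ltp; rewrite raddfB /= !pairing_eps; lia. Qed.

Lemma prodA_weight a : weight a != 0 -> prodA m a = 0.
Proof.
move=> a0; rewrite /prodA (prod_geomE _ (@pairing_rootA_gt0)).
apply: fsbig1 => e /= ea; case/eqP: a0.
rewrite -ea weightE raddf_sum big1 // => p _.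
by rewrite raddfMn raddfB /= !pairing_eps subrr mul0rn.
Qed.

Lemma prodA_oppr_rev a : prodA m (- rev_row a) = prodA m a.
Proof.
apply: (prod_geom_symm (phi := -%R \o @rev_row m) _ (@pairing_rootA_gt0)
  (@rev_pair_lt m) (@rev_pairK m)).
  by move=> b c /= /oppr_inj /(inv_inj (@rev_rowK m)).
by move=> p; rewrite /= raddfB /= !rev_row_eps opprB.
Qed.

(** With R the reversal, [hat n lambda + rho m] is the constant vector n + m + 1 minus R(lambda +
    rho), and likewise for [mu]. Constant vectors are fixed by permutations and cancel; conjugating
    [s] by R leaves -R of the argument on the right, and [prodA] is invariant under -R. *)
Lemma KA_rev (n : int) (lambda mu delta : 'rV[int]_m) :
  KA (hat n lambda) (hat n mu + rev_row delta) =
  \sum_(s : 'S_m) (-1) ^+ coxeter_length s *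
    prodA m (permact s (lambda + rho m) - mu - rho m + delta).
Proof.
rewrite /KA (reindex_inj (conjg_inj (rev_perm m))).
apply: eq_bigr => s _; rewrite !sign_coxeter_length odd_permJ.
congr (_ * _); rewrite /partition_fun_A -prodA_oppr_rev; congr (prodA m _).
apply/rowP => i; rewrite !mxE -conjVg conjgE rev_permV !permM !rev_permE !rev_ordK.
have subz (j : 'I_m) : (m - j)%N%:Z = m%:Z - j%:Z by rewrite subzn // ltnW.
by rewrite /= !subKn // !subz !intS; ring.
Qed.

End TypeA.

(** * Types C and D treated together *)

(* [P] is [p.1 < p.2] in type D and [p.1 <= p.2] in type C. *)
Section TypeCD.

Variables (m : nat) (P : pred ('I_m * 'I_m)).
Implicit Types a delta : 'rV[int]_m.

(** This definition and the next three specialise by conversion to [prodD], [sumD], [cD], [Dset] and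
    to their type C analogues. *)
Definition prod_pairs : series m :=
  \big[@smul m/sone m]_(p | P p) geom (- (eps p.1 + eps p.2)).

Definition sum_pairs (e : {ffun {p | P p} -> nat}) : 'rV[int]_m :=
  \sum_p (eps (val p).1 + eps (val p).2) *+ e p.

Definition pairs_count delta : nat :=
  #|` fset_set [set e : {ffun {p | P p} -> nat} | delta = sum_pairs e] |%fset.

Definition pairs_set (k : nat) : set 'rV[int]_m :=
  [set delta | weight delta = (2 * k)%:Z /\ exists e, delta = sum_pairs e].

Lemma pairing_pair_gt0 (p : 'I_m * 'I_m) : P p ->
  0 < pairing (fun=> -1) (- (eps p.1 + eps p.2)).
Proof. by rewrite raddfN raddfD /= !pairing_eps. Qed.

Lemma weight_sum_pairs e : weight (sum_pairs e) = (2 * \sum_p e p)%:Z.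
Proof.
rewrite weightE raddf_sum big_distrr /= (big_morph Posz PoszD erefl).
by apply: eq_bigr => p _; rewrite raddfMn raddfD /= !pairing_eps; lia.
Qed.

Lemma pairs_le (k : nat) e p : weight (sum_pairs e) = (2 * k)%:Z -> (e p <= k)%N.
Proof. by rewrite weight_sum_pairs (bigD1 p) //=; lia. Qed.

Lemma finite_pairs_set k : finite_set (pairs_set k).
Proof.
apply: (@sub_finite_set _ _
  (sum_pairs @` [set e : {ffun {p | P p} -> nat} | forall p, (e p <= k)%N])); last first.
  exact: finite_image (finite_ffun_bounded _ _).
by move=> delta [wd [e de]]; exists e => // p; apply: pairs_le; rewrite -de.
Qed.

Lemma prod_pairsN delta :
  prod_pairs (- delta) =
  \sum_(e \in [set e | delta = sum_pairs e]) ('X^(\sum_p e p) : {poly int}).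
Proof.
rewrite /prod_pairs (prod_geomE _ pairing_pair_gt0); apply: eq_fsbigl.
have sumN (e : {ffun {p | P p} -> nat}) :
    \sum_p (- (eps (val p).1 + eps (val p).2)) *+ e p = - sum_pairs e.
  by rewrite /sum_pairs -sumrN; apply: eq_bigr => p _; rewrite mulNrn.
apply/seteqP; split=> e /=; rewrite sumN; first by move/oppr_inj.
by move=> ->.
Qed.

Lemma prod_pairsN_count (k : nat) delta : weight delta = (2 * k)%:Z ->
  prod_pairs (- delta) = (pairs_count delta)%:R * 'X^k.
Proof.
move=> wd; rewrite prod_pairsN.
have sumk e : delta = sum_pairs e -> (\sum_p e p)%N = k.
  move=> de; have := weight_sum_pairs e; rewrite -de wd => -[] /eqP.
  by rewrite eqn_mul2l => /eqP ->.
rewrite (eq_fsbigr (fun=> 'X^k)); last by move=> e /set_mem /sumk ->.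
(* All terms now equal 'X^k. Finiteness of the set of families makes the cardinal of its [fset_set]
   the true number of terms. *)
rewrite fsbig_finite; last first.
  apply: sub_finite_set (finite_ffun_bounded _ k) => e /= de p.
  by apply: pairs_le; rewrite -de.
by rewrite big_const_seq count_predT iter_addr_0 mulr_natl.
Qed.

Lemma prod_pairsN_eq0 (k : nat) delta : weight delta = (2 * k)%:Z ->
  ~ pairs_set k delta -> prod_pairs (- delta) = 0.
Proof.
move=> wd nd; rewrite prod_pairsN fsbig1 // => e de.
by case: nd; split=> //; exists e.
Qed.

Hypothesis P_rev : forall p, P (rev_pair p) = P p.

Lemma prod_pairs_rev a : prod_pairs (rev_row a) = prod_pairs a.
Proof.
apply: (prod_geom_symm (phi := @rev_row m) _ pairing_pair_gt0 P_rev
  (@rev_pairK m)); first exact: inv_inj (@rev_rowK m).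
by move=> p; rewrite [RHS]raddfN [in RHS](raddfD (@rev_row m)) /= !rev_row_eps addrC.
Qed.

(** After the substitution b = a + delta, the first factor vanishes unless [delta] has weight 2k,
    and among those the second vanishes off [pairs_set k]. *)
Lemma smul_prodA_prod_pairs (k : nat) a : weight a = - (2 * k)%:Z ->
  smul (prodA m) prod_pairs a =
  \sum_(delta \in pairs_set k) prodA m (a + delta) * prod_pairs (- delta).
Proof.
move=> wa; rewrite /smul.
rewrite (reindex_fsbigT (fun delta => a + delta)); last first.
  by exists (fun b => b - a) => b; rewrite ?[a + b]addrC ?addrK // addrC subrK.
under eq_fsbigr do rewrite opprD addNKr.
rewrite -(@fsbig_widen _ _ _ _ (pairs_set k)) // => delta [_ nd] /=.
have [wd|wd] := eqVneq (weight delta) (2 * k)%:Z.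
  by rewrite (prod_pairsN_eq0 wd nd) mulr0.
by rewrite prodA_weight ?mul0r // weightD wa addrC subr_eq0.
Qed.

Lemma alternating_smul_prod_pairs (n : int) (lambda mu : 'rV[int]_m) (k : nat) :
  weight mu - weight lambda = (2 * k)%:Z ->
  \sum_(s : 'S_m) (-1) ^+ coxeter_length s *
    smul (prodA m) prod_pairs (permact s (lambda + rho m) - mu - rho m) =
  \sum_(delta \in pairs_set k)
    (pairs_count delta)%:R * 'X^k * KA (hat n lambda) (hat n mu + delta).
Proof.
move=> wk.
(* Reindexing by the reversal is done on all vectors of weight 2k, where stability
   is clear: the coefficients vanish off [pairs_set k]. *)
have pairs_weight : pairs_set k `<=` [set delta | weight delta = (2 * k)%:Z].
  by move=> delta [].
transitivity (\sum_(delta \in pairs_set k)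
    prod_pairs (- delta) * KA (hat n lambda) (hat n mu + rev_row delta)).
  rewrite (fsbig_finite _ _ (finite_pairs_set k)).
  under [RHS]eq_bigr do rewrite KA_rev mulr_sumr.
  rewrite exchange_big; apply: eq_bigr => s _.
  (* The argument has weight [weight lambda - weight mu], that is -2k, whatever [s], so the same
     finite set of [delta] serves every permutation. *)
  rewrite (@smul_prodA_prod_pairs k); last first.
    by rewrite !weightD !weightN weight_permact weightD; lia.
  rewrite (fsbig_finite _ _ (finite_pairs_set k)) mulr_sumr.
  by apply: eq_bigr => delta _; rewrite mulrA mulrC.
rewrite (fsbig_widen _ _ _ pairs_weight); last first.
  by move=> delta [/= wd nd]; rewrite (prod_pairsN_eq0 wd nd) mul0r.
(* The counts are turned back into coefficients of [prod_pairs], whose vanishing off [pairs_set k]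
   and invariance under reversal are known. *)
rewrite [RHS](eq_fsbigr (fun delta =>
    prod_pairs (- delta) * KA (hat n lambda) (hat n mu + delta))); last first.
  by move=> delta /set_mem [wd _]; rewrite (prod_pairsN_count wd).
rewrite [RHS](fsbig_widen _ _ _ pairs_weight); last first.
  by move=> delta [/= wd nd]; rewrite (prod_pairsN_eq0 wd nd) mul0r.
rewrite [RHS](reindex_fsbig (@rev_row m) [set delta | weight delta = (2 * k)%:Z]).
  by apply: eq_fsbigr => delta _; rewrite -raddfN prod_pairs_rev.
split=> [delta /=|d d' _ _ /(inv_inj (@rev_rowK m))//|delta /= wd].
  by rewrite weight_rev_row.
by exists (rev_row delta); rewrite /= ?weight_rev_row ?rev_rowK.
Qed.

End TypeCD.

Theorem proposition6p2p1 (m : nat) (m_gt0 : (0 < m)%N)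
    (lambda mu : 'rV[int]_m) (k : nat)
    (hlambda : is_partition lambda) (hmu : is_partition mu)
    (hk : weight mu - weight lambda = (2 * k)%:Z) :
  let first := Ordinal m_gt0 in
  let n : int := Num.max (lambda 0 first) (mu 0 first) in
  u lambda mu =
    \sum_(delta \in Dset m k)
      (cD delta)%:R * 'X^k * KA (hat n lambda) (hat n mu + delta)
  /\
  U lambda mu =
    \sum_(delta \in Cset m k)
      (cC delta)%:R * 'X^k * KA (hat n lambda) (hat n mu + delta).
Proof.
move=> first n; split.
  exact: (alternating_smul_prod_pairs (P := fun p => (p.1 < p.2)%N)
    (@rev_pair_lt m) n hk).
exact: (alternating_smul_prod_pairs (P := fun p => (p.1 <= p.2)%N)
  (@rev_pair_le m) n hk).
Qed.
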